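(* Let $f:\mathbb{S}^{n-1}\to(0,\infty)$ be smooth and even, and let $\varphi:(0,\infty)\to(0,\infty)$ be smooth. Let $\Omega_0\subset\mathbb{R}^n$ be a smooth, origin-symmetric, strictly convex body. Suppose that one of the following two conditions holds. (i) There is $\mathcal{R}\in\Phi_0$ with $\mathcal{R}(s)=\int_0^s\frac{1}{t\varphi(t)}\,dt$ and $\mathcal{R}'\neq0$ on $(0,\infty)$, and there is $\hat C>0$ such that $\int_{\mathbb{S}^{n-1}}f(x)\mathcal{R}(1/|x\cdot\theta|)\,dx\le\hat C$ for all $\theta\in\mathbb{S}^{n-1}$, and $\int_{\mathbb{S}^{n-1}}f(x)\mathcal{R}(1/h(\Omega_0,x))\,dx>\hat C$. (ii) There is $\mathcal{R}\in\Psi_0$ with $\mathcal{R}(s)=\int_s^\infty\frac{1}{t\varphi(t)}\,dt$ and $\mathcal{R}'\neq0$ on $(0,\infty)$. Assume moreover that $\varphi$ is strictly increasing on $(0,\infty)$. Then the solution of $$\varphi(1/h)\,h\,(|\nabla h|^2+h^2)^{-\frac n2}\det(\nabla^2h+hI)=f\quad\text{on }\mathbb{S}^{n-1}$$ is unique; that is, if $h_1$ and $h_2$ are two solutions, then $h_1=h_2$.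
   Context: $\mathbb{S}^{n-1}$ is the unit sphere in $\mathbb{R}^n$ with surface measure $dx$; $\nabla$ and $\nabla^2$ are the spherical gradient and Hessian, and $I$ is the identity. The support function of a convex body $\Omega$ (compact convex set with non-empty interior) is $h(\Omega,x)=\max\{x\cdot Y:Y\in\Omega\}$. A smooth strictly convex body is one with smooth boundary of positive Gauss curvature. A solution of the equation means a smooth positive function $h$ on $\mathbb{S}^{n-1}$ with $\nabla^2h+hI$ positive definite (i.e. the support function of a smooth strictly convex body containing the origin in its interior) satisfying the equation. $\Phi_0$ is the set of continuously differentiable strictly increasing $\mathcal{R}:(0,\infty)\to(0,\infty)$ with $\lim_{s\to0}\mathcal{R}(s)=0$, $\lim_{s\to\infty}\mathcal{R}(s)=\infty$. $\Psi_0$ is the set of continuously differentiable strictly decreasing $\mathcal{R}:(0,\infty)\to(0,\infty)$ with $\lim_{s\to0}\mathcal{R}(s)=\infty$, $\lim_{s\to\infty}\mathcal{R}(s)=0$. *)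

(* Defs.v *)
From HB Require Import structures.
From mathcomp Require Import all_boot all_order all_algebra.
From mathcomp Require Import all_classical all_reals all_analysis.
Import Order.TTheory GRing.Theory Num.Theory.
Import numFieldNormedType.Exports.

Set Implicit Arguments.
Unset Strict Implicit.
Unset Printing Implicit Defensive.

Local Open Scope classical_set_scope.
Local Open Scope ring_scope.

(* MathComp-Analysis norms 'rV[R]_n with the sup norm, so the Euclidean
   structure is introduced separately; the two induce the same topology. *)
Definition dot (R : realType) (n : nat) (x y : 'rV[R]_n) : R :=
  \sum_(i < n) x 0 i * y 0 i.

Definition enorm (R : realType) (n : nat) (x : 'rV[R]_n) : R :=
  Num.sqrt (dot x x).

Definition sphere (R : realType) (n : nat) : set 'rV[R]_n :=
  [set x | enorm x = 1].
Arguments sphere : clear implicits.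

Definition normalize (R : realType) (n : nat) (y : 'rV[R]_n) : 'rV[R]_n :=
  (enorm y)^-1 *: y.

Definition partial (R : realType) (n : nat) (i : 'I_n) (F : 'rV[R]_n -> R) :
    'rV[R]_n -> R :=
  fun x => 'D_(delta_mx 0 i) F x.

Definition grad (R : realType) (n : nat) (F : 'rV[R]_n -> R) (x : 'rV[R]_n) :
    'rV[R]_n :=
  \row_i partial i F x.

(* C^oo on the open set U: all iterated partial derivatives of F, of every
   order (including F itself), are differentiable at every point of U. *)
Definition smooth_on (R : realType) (n : nat) (U : set 'rV[R]_n)
    (F : 'rV[R]_n -> R) : Prop :=
  forall (s : seq 'I_n) (x : 'rV[R]_n), U x ->
    differentiable (foldr (@partial R n) F s) x.

(* A function on the sphere is represented by a function on R^n of which only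
   the values on the sphere matter: every notion below depends on h only
   through its extension to R^n minus the origin that is constant on rays. *)
Definition radial_ext (R : realType) (n : nat) (h : 'rV[R]_n -> R) :
    'rV[R]_n -> R :=
  fun y => h (normalize y).

Definition smooth_on_sphere (R : realType) (n : nat) (h : 'rV[R]_n -> R) :
    Prop :=
  smooth_on [set y : 'rV[R]_n | y != 0] (radial_ext h).

(* The extension is constant on rays, so its Euclidean gradient at a point x
   of the sphere is tangent to the sphere and is the spherical gradient. *)
Definition sgrad (R : realType) (n : nat) (h : 'rV[R]_n -> R)
    (x : 'rV[R]_n) : 'rV[R]_n :=
  grad (radial_ext h) x.

(* The spherical Hessian at x on tangent vectors v, w: the covariant derivative
   of the spherical gradient along v, paired with w. The Levi-Civita connection
   of the sphere is the tangential part of the ambient derivative, and pairing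
   with w tangent to the sphere discards the normal part. *)
Definition shess (R : realType) (n : nat) (h : 'rV[R]_n -> R)
    (x v w : 'rV[R]_n) : R :=
  dot ('D_v (fun y => sgrad h (normalize y)) x) w.

(* The rows of E form an orthonormal basis of the hyperplane orthogonal to the
   (nonzero) vector nu; for nu in the sphere, of the tangent space at nu. *)
Definition orthonormal_frame (R : realType) (n : nat) (nu : 'rV[R]_n)
    (E : 'M[R]_(n.-1, n)) : Prop :=
  (forall i j, dot (row i E) (row j E) = (i == j)%:R) /\
  (forall i, dot (row i E) nu = 0).

(* The matrix of nabla^2 h + h I at x in the orthonormal frame E. *)
Definition shess_plus_mx (R : realType) (n : nat) (h : 'rV[R]_n -> R)
    (x : 'rV[R]_n) (E : 'M[R]_(n.-1, n)) : 'M[R]_(n.-1) :=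
  (\matrix_(i, j) shess h x (row i E) (row j E)) + (h x)%:M.

Definition smooth_pos (R : realType) (phi : R -> R) : Prop :=
  forall (k : nat) (t : R), 0 < t -> derivable (derive1n k phi) t 1.

(* Smooth positive h with nabla^2 h + h I positive definite, solving
   phi(1/h) h (|nabla h|^2 + h^2)^(-n/2) det(nabla^2 h + h I) = f. The
   determinant is that of an operator on the tangent space, so it does not
   depend on the orthonormal frame used to compute it. *)
Definition is_solution (R : realType) (n : nat) (phi : R -> R)
    (f h : 'rV[R]_n -> R) : Prop :=
  [/\ smooth_on_sphere h,
      forall x, sphere R n x -> 0 < h x,
      forall x, sphere R n x -> forall v, dot v x = 0 -> v != 0 ->
        0 < shess h x v v + h x * dot v v
    & forall x, sphere R n x -> forall E, orthonormal_frame x E ->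
        phi (1 / h x) * h x *
          ((enorm (sgrad h x) ^+ 2 + h x ^+ 2) `^ (- (n%:R / 2))) *
          \det (shess_plus_mx h x E) = f x].

Definition C1_pos (R : realType) (r : R -> R) : Prop :=
  forall s : R, 0 < s -> derivable r s 1 /\ {for s, continuous (derive1 r)}.

Definition Phi0 (R : realType) (r : R -> R) : Prop :=
  [/\ forall s, 0 < s -> 0 < r s,
      C1_pos r,
      forall s t, 0 < s -> s < t -> r s < r t,
      r s @[s --> 0^'+] --> (0 : R)
    & r s @[s --> +oo] --> +oo].

Definition Psi0 (R : realType) (r : R -> R) : Prop :=
  [/\ forall s, 0 < s -> 0 < r s,
      C1_pos r,
      forall s t, 0 < s -> s < t -> r t < r s,
      r s @[s --> 0^'+] --> +oo
    & r s @[s --> +oo] --> (0 : R)].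

(* n-dimensional Lebesgue measure, as iterated product measure on n-tuples. *)
Section lebesgue_tuple.
Variable R : realType.
Notation RR := (measurableTypeR R).

Section step.
Variables (n : nat) (m : {sigma_finite_measure set (n.-tuple RR) -> \bar R}).

Definition cons_pair (p : RR * n.-tuple RR) : n.+1.-tuple RR :=
  [the n.+1.-tuple RR of p.1 :: p.2].

Lemma measurable_cons_pair : measurable_fun [set: RR * n.-tuple RR] cons_pair.
Proof. by apply: measurable_cons. Qed.

HB.instance Definition _ :=
  isMeasurableFun.Build _ _ _ _ cons_pair measurable_cons_pair.

Definition lebesgue_step : set (n.+1.-tuple RR) -> \bar R :=
  pushforward (@lebesgue_measure R \x m)%E cons_pair.

Lemma lebesgue_step_sigma_finite : sigma_finite setT lebesgue_step.
Proof.
have /sigma_finiteP[F [TF ndF Foo]] := sigma_finiteT (@lebesgue_measure R).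
have /sigma_finiteP[G [TG ndG Goo]] := sigma_finiteT m.
pose u (y : n.+1.-tuple RR) : RR * n.-tuple RR :=
  (tnth y ord0, [tuple of behead y]).
have mu1 : measurable_fun [set: n.+1.-tuple RR] u.
  by apply: measurable_fun_pair; [exact: measurable_tnth|exact: measurable_behead].
have uK p : u (cons_pair p) = p.
  by case: p => a b; rewrite /u /cons_pair /=; congr pair; apply/val_inj.
exists (fun k => u @^-1` (F k `*` G k)).
  rewrite -preimage_bigcup; apply/seteqP; split => // y _ /=.
  have [i _ Fi] : (\bigcup_k F k) (u y).1 by rewrite -TF.
  have [j _ Gj] : (\bigcup_k G k) (u y).2 by rewrite -TG.
  exists (maxn i j) => //; split.
  - by have /subsetPset := ndF _ _ (leq_maxl i j); apply.
  - by have /subsetPset := ndG _ _ (leq_maxr i j); apply.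
move=> k; have [mF Fk] := Foo k; have [mG Gk] := Goo k; split.
  by rewrite -[X in measurable X]setTI; apply: mu1 => //; exact: measurableX.
rewrite /lebesgue_step /pushforward.
rewrite -comp_preimage (_ : u \o cons_pair = id); last exact/funext.
rewrite preimage_id.
by rewrite product_measure1E// lte_mul_pinfty// ge0_fin_numE.
Qed.

Let step0 : lebesgue_step set0 = 0%E.
Proof. by rewrite /lebesgue_step /pushforward preimage_set0 measure0. Qed.

Let step_ge0 A : (0 <= lebesgue_step A)%E.
Proof. exact: (measure_ge0 (pushforward _ cons_pair)). Qed.

Let step_sigma_additive : semi_sigma_additive lebesgue_step.
Proof. exact: (@measure_semi_sigma_additive _ _ _ (pushforward _ cons_pair)). Qed.

HB.instance Definition _ := isMeasure.Build _ _ _ lebesgue_step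
  step0 step_ge0 step_sigma_additive.

HB.instance Definition _ := Measure_isSigmaFinite.Build _ _ _ lebesgue_step
  lebesgue_step_sigma_finite.
End step.

Fixpoint lebesgue_tuple (n : nat) :
    {sigma_finite_measure set (n.-tuple RR) -> \bar R} :=
  match n with
  | 0 => dirac [tuple]
  | n'.+1 => lebesgue_step (lebesgue_tuple n')
  end.
End lebesgue_tuple.

Definition row_of_tuple (R : realType) (n : nat)
    (y : n.-tuple (measurableTypeR R)) : 'rV[R]_n :=
  \row_i tnth y i.

(* Integral of g over the sphere with respect to the surface measure, which is
   the cone measure sigma A = n * Lebesgue {r x | 0 < r <= 1, x in A}: it is n
   times the image of Lebesgue measure on the punctured unit ball under
   y |-> y / |y|. *)
Definition sphere_integral (R : realType) (n : nat) (g : 'rV[R]_n -> \bar R) :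
    \bar R :=
  (n%:R%:E *
   \int[lebesgue_tuple R n]_(y in [set y | (0 < enorm (row_of_tuple y) <= 1)%R])
     g (normalize (row_of_tuple y)))%E.

Definition unit_normal (R : realType) (n : nat) (rho : 'rV[R]_n -> R)
    (p : 'rV[R]_n) : 'rV[R]_n :=
  normalize (grad rho p).

(* The matrix in the frame E of the shape operator, i.e. of the differential of
   the unit normal field, of the hypersurface rho = 0. *)
Definition shape_mx (R : realType) (n : nat) (rho : 'rV[R]_n -> R)
    (p : 'rV[R]_n) (E : 'M[R]_(n.-1, n)) : 'M[R]_(n.-1) :=
  \matrix_(i, j) dot ('D_(row i E) (unit_normal rho) p) (row j E).

(* Compact convex set with non-empty interior which near each boundary point p
   is a sublevel set {rho <= 0} of a smooth function with grad rho p <> 0, such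
   that the boundary has positive Gauss curvature at p. The curvature is the
   determinant of the shape operator for the outer normal grad rho / |grad rho|,
   with the sign that makes the unit sphere positively curved. *)
Definition smooth_strictly_convex_body (R : realType) (n : nat)
    (Omega : set 'rV[R]_n) : Prop :=
  [/\ compact Omega,
      convex_set (Omega : set (convex_lmodType 'rV[R]_n)),
      Omega° !=set0
    & forall p, Omega p -> ~ Omega° p ->
        exists (U : set 'rV[R]_n) (rho : 'rV[R]_n -> R),
          [/\ open U /\ U p,
              smooth_on U rho,
              forall y, U y -> (Omega y <-> rho y <= 0),
              grad rho p != 0
            & forall E, orthonormal_frame (unit_normal rho p) E ->
                0 < \det (shape_mx rho p E)]].

(* For Omega compact and nonempty the supremum is attained. *)
Definition support_function (R : realType) (n : nat) (Omega : set 'rV[R]_n)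
    (x : 'rV[R]_n) : R :=
  sup [set dot x y | y in Omega].

(* Main.v *)
Require Import Defs.
From HB Require Import structures.
From mathcomp Require Import all_boot all_order all_algebra.
From mathcomp Require Import all_classical all_reals all_analysis.
From mathcomp Require Import ring lra.
Import Order.TTheory GRing.Theory Num.Theory.
Import numFieldNormedType.Exports.

(** Uniqueness is a maximum principle applied to the ratio of two solutions.
The sphere is compact, so [h1 / h2] attains its maximum, say [t] at the point
[c].  If [h1 <= h2] fails somewhere then [t > 1].  The function [h1 - t h2] is
nonpositive and vanishes at [c], hence at [c] the value and the gradient of [h1]
are [t] times those of [h2], and the Hessian of [h1] is at most [t] times that of
[h2] ([touching_jets]).  Since the determinant is monotone on positive definite
symmetric matrices ([ler_det_posdef]), the determinant of
[Hess h1 + h1 I] is at most [t ^ (n-1)] times that of [Hess h2 + h2 I].  The factor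
[h (|grad h|^2 + h^2) ^ (-n/2)] is homogeneous of degree [1 - n] in the 1-jet of
[h], so these powers of [t] cancel, and the two equations at [c] give
[phi (1 / (t h2)) >= phi (1 / h2)].  This contradicts that [phi] is strictly
increasing and [t > 1].  Exchanging the two solutions gives equality.

All derivatives are computed on the extensions [H] of the [h] that are constant
on rays.  The spherical Hessian on tangent vectors is then the Euclidean Hessian
of [H] ([shessE]).  The determinant comparison needs this Hessian to be
symmetric, and the comparison of Hessians is a second derivative test; both
facts are read off one limit, that of the second difference of a function along
two directions ([second_difference_cvg]). *)

Set Implicit Arguments.
Unset Strict Implicit.
Unset Printing Implicit Defensive.

Local Open Scope classical_set_scope.
Local Open Scope ring_scope.

(** * Monotonicity of the determinant *)

Definition quad (R : realFieldType) (n : nat) (A : 'M[R]_n) (u : 'rV[R]_n) : R :=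
  (u *m A *m u^T) 0 0.

Lemma quad_congruence (R : realFieldType) (m n : nat) (M : 'M[R]_n)
    (E : 'M[R]_(m, n)) (u : 'rV[R]_m) :
  quad (E *m M *m E^T) u = quad M (u *m E).
Proof. by rewrite /quad trmx_mul !mulmxA. Qed.

(** Let [D] be the lower right block of [A] and [b] the rest of its first row.
Replacing the first row of [A] by [(1, u) A], with [u = - b D^-1], makes [A] block
triangular.  The new corner is the Schur complement of [D], written here as a value of the quadratic form so that two
matrices can be compared. *)
Lemma det_schur (R : realFieldType) (n : nat) (A : 'M[R]_(1 + n)) :
  drsubmx A \in unitmx ->
  exists u : 'rV[R]_n,
    row_mx 1 u *m A = row_mx (quad A (row_mx 1 u))%:M 0 /\
    \det A = quad A (row_mx 1 u) * \det (drsubmx A).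
Proof.
move=> uD; pose u := - (ursubmx A *m invmx (drsubmx A)); exists u.
pose s := ulsubmx A + u *m dlsubmx A.
have uA : row_mx 1 u *m A = row_mx s 0.
  rewrite -{1}(submxK A) mul_row_block !mul1mx.
  have ->: u *m drsubmx A = - ursubmx A by rewrite mulNmx mulmxKV.
  by rewrite subrr.
have sE : quad A (row_mx 1 u) = s 0 0.
  by rewrite /quad uA tr_row_mx mul_row_col mul0mx addr0 trmx1 mulmx1.
split; first by rewrite uA sE [s in LHS]mx11_scalar.
pose L : 'M[R]_(1 + n) := block_mx 1 u 0 1%:M.
have LA : L *m A = block_mx s 0 (dlsubmx A) (drsubmx A).
  have := uA; rewrite -{1}(submxK A) mul_row_block => /eq_row_mx[e1 e2].
  by rewrite -{1}(submxK A) mulmx_block e1 e2 !mul0mx !mul1mx !add0r.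
have := congr1 determinant LA.
rewrite det_mulmx det_ublock det_lblock !det1 !mul1r => ->.
by rewrite sE det_mx11.
Qed.

(** Induction on the size through [\det A = s * \det D], with [s] the Schur
complement of [D].  As [s] is the minimum of the quadratic form over the vectors
with first coordinate 1, it grows with the form, as does [\det D] by
induction. *)
Lemma ler_det_posdef (R : realFieldType) (n : nat) (A B : 'M[R]_n) :
  A^T = A -> (forall u, u != 0 -> 0 < quad A u) ->
  (forall u, quad A u <= quad B u) ->
  0 < \det A <= \det B.
Proof.
elim: n => [|n IH] in A B *; first by rewrite !det_mx00 ltr01 lexx.
move: A B; rewrite -[n.+1]/(1 + n)%N => A B symA posA leAB.
have quadD (M : 'M[R]_(1 + n)) z :
    quad (drsubmx M) z = quad M (row_mx 0 z : 'rV_(1 + n)).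
  rewrite /quad -[M in RHS]submxK.
  by rewrite mul_row_block tr_row_mx mul_row_col trmx0 !mul0mx mulmx0 !add0r.
have /andP[DA0 DAB] : 0 < \det (drsubmx A) <= \det (drsubmx B).
  apply: IH => [|z z0|z]; first by rewrite trmx_drsub symA.
  - rewrite quadD posA//; apply: contraNneq z0 => zz; apply/eqP.
    by rewrite -(row_mxKr 0 z : rsubmx (row_mx 0 z : 'rV_(1 + n)) = z) zz linear0.
  - by rewrite !quadD.
have uDA : drsubmx A \in unitmx by rewrite unitmxE unitfE gt_eqF.
have uDB : drsubmx B \in unitmx by rewrite unitmxE unitfE gt_eqF// (lt_le_trans DA0).
have [u [uA ->]] := @det_schur _ _ A uDA.
have [w [_ ->]] := @det_schur _ _ B uDB.
set a := row_mx 1 u in uA *; set b := row_mx 1 w.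
have qa0 : 0 < quad A a.
  apply: posA; apply/eqP => a0; have : lsubmx a = 1 by rewrite row_mxKl.
  by rewrite a0 linear0 => /eqP; rewrite eq_sym oner_eq0.
(* [a] minimizes [quad A] among the vectors with first coordinate 1, because
   [a *m A] is orthogonal to the vectors with first coordinate 0. *)
have qab : quad A a <= quad A b.
  pose z : 'rV_(1 + n) := row_mx 0 (w - u).
  have bE : b = a + z by rewrite add_row_mx addr0 addrC subrK.
  have az : a *m A *m z^T = 0.
    by rewrite uA tr_row_mx mul_row_col mul0mx trmx0 mulmx0 addr0.
  have za : z *m A *m a^T = 0.
    by apply: trmx_inj; rewrite !trmx_mul trmxK symA mulmxA az trmx0.
  have -> : quad A b = quad A a + quad A z.
    by rewrite bE /quad linearD/= mulmxDl mulmxDl !mulmxDr az za addr0 add0r mxE.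
  rewrite lerDl; have [->|z0] := eqVneq z 0; last by rewrite ltW ?posA.
  by rewrite /quad !mul0mx mxE.
have sab : quad A a <= quad B b by apply: (le_trans qab).
by rewrite mulr_gt0//= ler_pM// ltW.
Qed.

(** * The sphere and its tangent spaces *)

Lemma dotE (R : realType) (n : nat) (x y : 'rV[R]_n) : dot x y = (x *m y^T) 0 0.
Proof. by rewrite mxE; apply: eq_bigr => i _; rewrite mxE. Qed.

Lemma dot_ge0 (R : realType) (n : nat) (x : 'rV[R]_n) : 0 <= dot x x.
Proof. by apply: sumr_ge0 => i _; rewrite -expr2 sqr_ge0. Qed.

Lemma dot_eq0 (R : realType) (n : nat) (x : 'rV[R]_n) : (dot x x == 0) = (x == 0).
Proof.
apply/idP/eqP => [|->]; last by rewrite /dot big1// => i _; rewrite mxE mul0r.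
rewrite psumr_eq0 => [/allP x0|i _]; last by rewrite -expr2 sqr_ge0.
apply/rowP => i; have := x0 i; rewrite mem_index_enum => /(_ isT).
by rewrite mulf_eq0 orbb mxE => /eqP.
Qed.

Lemma dotZ (R : realType) (n : nat) (c : R) (x : 'rV[R]_n) :
  dot (c *: x) (c *: x) = c ^+ 2 * dot x x.
Proof. by rewrite /dot mulr_sumr; apply: eq_bigr => i _; rewrite !mxE; ring. Qed.

Lemma sphereP (R : realType) (n : nat) (x : 'rV[R]_n) : sphere R n x <-> dot x x = 1.
Proof.
have d0 := dot_ge0 x.
split=> [x1|x1]; last by rewrite /sphere /= /enorm x1 sqrtr1.
by rewrite -(sqr_sqrtr d0) -/(enorm x) x1 expr1n.
Qed.

Lemma quad_add_scalar (R : realType) (n : nat) (M : 'M[R]_n) (a : R) (u : 'rV[R]_n) :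
  quad (M + a%:M) u = quad M u + a * dot u u.
Proof.
by rewrite /quad mulmxDr mul_mx_scalar mulmxDl -scalemxAl mxE [X in _ + X]mxE dotE.
Qed.

(** The Householder reflection [H] in the direction [e - x], [e] the first basis
vector, exchanges [e] and [x].  It is an orthogonal matrix with first row [x], so
its other rows form the frame. *)
Lemma orthonormal_frame_exists (R : realType) (n : nat) (x : 'rV[R]_n) :
  (0 < n)%N -> dot x x = 1 -> exists E, orthonormal_frame x E.
Proof.
case: n x => // n x _ x1.
pose e : 'rV[R]_n.+1 := delta_mx 0 0; pose w := e - x.
pose c := (1 - x 0 0)^-1; pose H := 1%:M - c *: (w^T *m w).
pose k := 1 - x 0 0.
have ww : w *m w^T = (2 * k)%:M.
  rewrite [LHS]mx11_scalar; congr _%:M.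
  have -> : (w *m w^T) 0 0 = dot e e - 2 * dot e x + dot x x.
    rewrite -dotE /dot mulr_sumr -sumrB -big_split/=; apply: eq_bigr => i _.
    have -> : w 0 i = e 0 i - x 0 i by rewrite !mxE.
    by ring.
  have eE y : dot e y = y 0 0.
    rewrite /dot (bigD1 ord0)//= big1 => [|i /negPf i0]; rewrite !mxE ?i0 ?mul0r//.
    by rewrite !eqxx mul1r addr0.
  by rewrite !eE x1 /k !mxE !eqxx /=; ring.
have symH : H^T = H.
  by rewrite linearB/= linearZ/= tr_scalar_mx trmx_mul trmxK.
have HH : H *m H^T = 1%:M.
  rewrite symH mulmxBl mul1mx mulmxBr mulmx1 -scalemxAl -scalemxAr.
  rewrite mulmxA -[w^T *m w *m w^T]mulmxA ww mul_mx_scalar -scalemxAl.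
  rewrite !scalerA -scalerBl.
  suff -> : c - c * (c * (2 * k)) = - c by rewrite scaleNr opprK subrK.
  rewrite /c -/k; have [->|k0] := eqVneq k 0; first by rewrite invr0; ring.
  by field.
have row0 : row 0 H = x.
  (* If [x] is the first basis vector then [k = 0], so [c = 0] and [H] is the
     identity: the formulas for the reflection stay valid. *)
  have w0 : k = 0 -> w = 0.
    move=> k0; apply/eqP; rewrite -dot_eq0 dotE ww k0 mulr0.
    by rewrite mxE mul0rn.
  rewrite linearB/= linearZ/= row_mul row1 -/e.
  have -> : row 0 w^T *m w = k *: w.
    by rewrite -mul_scalar_mx; congr (_ *m _); apply/rowP => i; rewrite !ord1 !mxE !eqxx.
  rewrite scalerA /c -/k; have [/w0 w00|k0] := eqVneq k 0.
    by rewrite w00 scaler0 subr0; apply/eqP; rewrite -subr_eq0 -/w w00.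
  by rewrite mulVf// scale1r subKr.
have HHE i j : dot (row i H) (row j H) = (i == j)%:R.
  have -> : (i == j)%:R = (1%:M : 'M[R]_n.+1) i j by rewrite mxE.
  rewrite -HH mxE.
  by apply: eq_bigr => l _; rewrite !mxE.
exists (row' 0 H); have rowE i : row i (row' 0 H) = row (lift 0 i) H.
  by apply/rowP => j; rewrite !mxE.
by split=> [i j|i]; rewrite !rowE -?[in LHS]row0 HHE ?(inj_eq lift_inj).
Qed.

Lemma orthonormal_frame_mul (R : realType) (n : nat) (x : 'rV[R]_n)
    (E : 'M[R]_(n.-1, n)) :
  orthonormal_frame x E -> E *m E^T = 1%:M.
Proof.
move=> [EE _]; apply/matrixP => i j.
by rewrite !mxE -EE; apply: eq_bigr => k _; rewrite !mxE.
Qed.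

Lemma orthonormal_frame_tangent (R : realType) (n : nat) (x : 'rV[R]_n)
    (E : 'M[R]_(n.-1, n)) (u : 'rV[R]_n.-1) :
  orthonormal_frame x E -> dot (u *m E) x = 0.
Proof.
move=> [_ Ex]; rewrite dotE -mulmxA (_ : E *m x^T = 0) ?mulmx0 ?mxE//.
apply/matrixP => i j; rewrite [RHS]mxE -(Ex i) dotE ord1 !mxE.
by apply: eq_bigr => k _; rewrite !mxE.
Qed.

Lemma enorm_gt0 (R : realType) (n : nat) (x : 'rV[R]_n) : (0 < enorm x) = (x != 0).
Proof. by rewrite sqrtr_gt0 lt_neqAle dot_ge0 andbT eq_sym dot_eq0. Qed.

Lemma enormZ (R : realType) (n : nat) (c : R) (x : 'rV[R]_n) :
  enorm (c *: x) = `|c| * enorm x.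
Proof. by rewrite /enorm dotZ sqrtrM ?sqr_ge0// sqrtr_sqr. Qed.

Lemma normalizeZ (R : realType) (n : nat) (c : R) (x : 'rV[R]_n) :
  0 < c -> normalize (c *: x) = normalize x.
Proof.
move=> c0; rewrite /normalize enormZ gtr0_norm// invfM scalerA.
by rewrite mulrAC mulVf ?mul1r ?gt_eqF.
Qed.

Lemma normalize_sphere (R : realType) (n : nat) (x : 'rV[R]_n) :
  x != 0 -> sphere R n (normalize x).
Proof.
move=> x0; have e0 : 0 < enorm x by rewrite enorm_gt0.
by rewrite /sphere /= /normalize enormZ gtr0_norm ?invr_gt0// mulVf// gt_eqF.
Qed.

Lemma sphere_neq0 (R : realType) (n : nat) (x : 'rV[R]_n) : sphere R n x -> x != 0.
Proof. by rewrite /sphere /= => x1; rewrite -enorm_gt0 x1 ltr01. Qed.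

Lemma near_neq0 (R : realType) (n : nat) (x : 'rV[R]_n) :
  x != 0 -> \forall y \near x, y != 0.
Proof.
move=> x0; apply: (@cvgr_neq0 R 'rV[R]_n _ (nbhs x) _ id x _ x0); exact: cvg_id.
Qed.

Lemma dot_sumE (R : realType) (n : nat) :
  (fun y : 'rV[R]_n => dot y y) =
  \sum_i ((fun y : 'rV[R]_n => y 0 i) * (fun y : 'rV[R]_n => y 0 i)).
Proof. by apply/funext => y; rewrite fct_sumE. Qed.

Lemma differentiable_dot (R : realType) (n : nat) (x : 'rV[R]_n) :
  differentiable (fun y : 'rV[R]_n => dot y y) x.
Proof.
rewrite dot_sumE; apply: differentiable_sum => i.
by apply: differentiableM; exact: differentiable_coord.
Qed.

Lemma derive_dot (R : realType) (n : nat) (x v : 'rV[R]_n) :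
  'D_v (fun y : 'rV[R]_n => dot y y) x = 2 * dot v x.
Proof.
have dq (i : 'I_n) : derivable (fun y : 'rV[R]_n => y 0 i) x v.
  by apply: diff_derivable; exact: differentiable_coord.
rewrite dot_sumE derive_sum => [|i]; last exact: derivableM.
rewrite /dot mulr_sumr; apply: eq_bigr => i _; rewrite deriveM//.
have -> : 'D_v (fun y : 'rV[R]_n => y 0 i) x = v 0 i.
  have := derive_mx (@derivable_id R _ x v).
  by rewrite derive_id => /matrixP/(_ 0 i); rewrite mxE => ->.
rewrite -[_ *: _]/(_ * _); ring.
Qed.

Lemma is_derive_enorm (R : realType) (n : nat) (x v : 'rV[R]_n) :
  sphere R n x -> dot v x = 0 -> is_derive x v (@enorm R n) 0.
Proof.
move=> x1 vx; have xx := (sphereP x).1 x1.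
have dd := @differentiable_dot _ _ x.
have dv : 'd (fun y : 'rV[R]_n => dot y y) x v = 0.
  by rewrite -deriveE// derive_dot vx mulr0.
have ds : differentiable (@Num.sqrt R) (dot x x).
  by apply/derivable1_diffP; rewrite xx; apply: ex_derive; exact: is_derive1_sqrt.
split; first by apply: diff_derivable; exact: (differentiable_comp dd ds).
rewrite deriveE; last exact: (differentiable_comp dd ds).
by rewrite (diff_comp dd ds) /= dv linear0.
Qed.

Lemma compact_sphere (R : realType) (n : nat) : compact (sphere R n).
Proof.
apply: bounded_closed_compact.
  exists 1; split=> // M M1 x /sphereP x1.
  rewrite /= [leLHS]/Num.Def.normr/= mx_normrE; apply: bigmax_le => [|[i j] _/=].
    by rewrite ltW// (lt_trans ltr01).
  rewrite (le_trans _ (ltW M1))// ord1 -(@ler_pXn2r _ 2)// ?nnegrE// expr1n.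
  rewrite real_normK ?num_real// -x1 /dot (bigD1 j)//= expr2 lerDl.
  by apply: sumr_ge0 => k _; rewrite -expr2 sqr_ge0.
have -> : sphere R n = (fun y : 'rV[R]_n => dot y y) @^-1` [set 1].
  by apply/seteqP; split=> y /sphereP.
apply: closed_comp => [y _|]; last exact: closed_eq.
apply: differentiable_continuous; exact: differentiable_dot.
Qed.

(** * Second differences *)

Lemma diff_near_le (R : realType) (V : normedModType R) (P : V -> R) (x : V) (e : R) :
  differentiable P x -> 0 < e ->
  \forall y \near 0, `|P (x + y) - P x - 'd P x y| <= e * `|y|.
Proof.
move=> dP e0; have /eqaddoP/(_ _ e0) := diff_locally dP.
by apply: filterS => y /=; rewrite !fctE /= opprD addrA [y + x]addrC.
Qed.

Lemma is_derive_line (R : realType) (V : normedModType R) (F : V -> R) (a u : V)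
    (r d : R) :
  is_derive (a + r *: u) u F d -> is_derive r 1 (fun r => F (a + r *: u)) d.
Proof.
move=> [dF DF].
have E : (fun h => h^-1 *: (F (h *: u + (a + r *: u)) - F (a + r *: u))) =
         (fun h : R => h^-1 *: (F (a + (h *: 1 + r) *: u) - F (a + r *: u))).
  apply/funext => h; congr (_ *: (F _ - _)).
  by rewrite [h *: 1]mulr1 scalerDl addrCA.
split; first by rewrite /derivable /= -E.
by rewrite -DF /derive /= E.
Qed.

(** The mean value theorem in the direction [u] reduces the second difference to
a first difference of [P], the derivative of [F] in the direction [u], at two
points within distance [O(s)] of [x], to which the linear approximation of [P]
at [x] applies. *)
Lemma second_difference_cvg (R : realType) (V : normedModType R) (F P : V -> R)
    (x u v : V) :
  (\forall y \near x, is_derive y u F (P y)) -> differentiable P x ->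
  (F (x + s *: v + s *: u) - F (x + s *: v) - (F (x + s *: u) - F x)) / s ^+ 2
    @[s --> 0^'+] --> 'd P x v.
Proof.
move=> dF dP; apply/cvgrPdist_le => e e0.
pose K := `|u| + `|v| + 1.
have K0 : 0 < K by rewrite ltr_wpDl ?addr_ge0.
have e'0 : 0 < e / (2 * K) by rewrite divr_gt0// mulr_gt0.
have dF0 : \forall y \near (0 : V), is_derive (x + y) u F (P (x + y)).
  by move: dF; rewrite (near_shift 0 x); apply: filterS => y /=; rewrite subr0 addrC.
have /nbhs_norm0P[d /= d0 Hd] : \forall y \near (0 : V),
    is_derive (x + y) u F (P (x + y)) /\
    `|P (x + y) - P x - 'd P x y| <= e / (2 * K) * `|y|.
  by apply: filterI => //; exact: diff_near_le.
near=> s.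
have s0 : 0 < s by near: s; exact: nbhs_right_gt.
have sK : s * K < d.
  by rewrite -ltr_pdivlMr//; near: s; apply: nbhs_right_lt; rewrite divr_gt0.
pose g (r : R) := F (x + s *: v + r *: u) - F (x + r *: u).
pose dg (r : R) := P (x + s *: v + r *: u) - P (x + r *: u).
have small r w : 0 <= r <= s -> `|w| <= s * `|v| -> `|w + r *: u| <= s * K.
  move=> /andP[r0 rs] wv; rewrite (le_trans (ler_normD _ _))//.
  rewrite normrZ ger0_norm// /K !mulrDr mulr1.
  have := ler_wpM2r (normr_ge0 u) rs; lra.
have line w r : 0 <= r <= s -> `|w| <= s * `|v| ->
    is_derive r 1 (fun r => F (x + w + r *: u)) (P (x + w + r *: u)).
  move=> rs wv; have [/= H _] := Hd _ (le_lt_trans (small _ _ rs wv) sK).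
  by apply: is_derive_line; rewrite -addrA.
have v1 : `|s *: v| <= s * `|v| by rewrite normrZ gtr0_norm.
have v0 : `|0 : V| <= s * `|v| by rewrite normr0 mulr_ge0// ltW.
have dgP r : 0 <= r <= s -> is_derive r 1 g (dg r).
  move=> rs; apply: is_deriveB; first exact: line.
  by have := line _ _ rs v0; rewrite addr0.
(* The second difference is the increment over [0, s] of the first difference
   [g] in the direction [v], taken along the line in the direction [u]. *)
have [||c cs] := @MVT R g dg 0 s s0.
- by move=> r /[!in_itv]/= /andP[r0 rs]; apply: dgP; rewrite !ltW.
- by apply: derivable_within_continuous => r; rewrite in_itv/= => rs; have [] := dgP r rs.
have cs' : 0 <= c <= s by move: cs; rewrite in_itv/= => /andP[c0 c1]; rewrite !ltW.
rewrite /g !scale0r !addr0 subr0 => E.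
set Q := (X in X / _).
have -> : Q = dg c * s by rewrite /Q -E; ring.
have [/= _ H1] := Hd _ (le_lt_trans (small _ _ cs' v1) sK).
have [/= _ H0] := Hd _ (le_lt_trans (small _ _ cs' v0) sK).
have sn0 : s != 0 by rewrite gt_eqF.
have -> : dg c * s / s ^+ 2 = dg c / s by field.
rewrite -(ler_pM2r s0) -[X in _ * X <= _]gtr0_norm// -normrM mulrBl divfK//.
move: H1 H0; rewrite !linearD/= linear0 linearZ/= !add0r !addrA => H1 H0.
have n1 := small _ _ cs' v1.
have n0 := small _ _ cs' v0.
have {}H1 := le_trans H1 (ler_wpM2l (ltW e'0) n1).
rewrite add0r in n0.
have {}H0 := le_trans H0 (ler_wpM2l (ltW e'0) n0).
have EE : e / (2 * K) * (s * K) = e * s / 2 by field; rewrite gt_eqF.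
rewrite EE in H0 H1.
rewrite /dg.
move: H1 H0; rewrite !ler_norml (_ : s *: 'd P x v = s * 'd P x v)//; lra.
Unshelve. all: end_near.
Qed.

(** Young's form of the symmetry of mixed derivatives: the second difference is
symmetric in the two directions. *)
Lemma mixed_derivativesC (R : realType) (V : normedModType R) (F P Q : V -> R)
    (x u v : V) :
  (\forall y \near x, is_derive y u F (P y)) ->
  (\forall y \near x, is_derive y v F (Q y)) ->
  differentiable P x -> differentiable Q x ->
  'd P x v = 'd Q x u.
Proof.
move=> dFu dFv dP dQ.
have := second_difference_cvg dFu dP (v := v).
have := second_difference_cvg dFv dQ (v := u).
set f := (X in X @ _ --> _ -> _); set g := (X in _ -> X @ _ --> _ -> _).
have -> : f = g.
  by apply/funext => s; rewrite /f /g [x + s *: u + s *: v]addrAC; congr (_ / _); ring.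
by move=> fQ fP; exact: (cvg_unique _ fP fQ).
Qed.

Lemma near_line (R : realType) (V : normedModType R) (x u : V) (A : set V) :
  nbhs x A -> \forall s \near (0 : R), A (x + s *: u).
Proof.
move=> xA; have /(_ A) : (fun s : R => x + s *: u) s @[s --> (0:R)] --> x.
  rewrite -[X in _ --> X](addr0 x) -[in X in _ --> X](scale0r u).
  apply: cvgD; first exact: cvg_cst.
  by apply: cvgZr_tmp; exact: cvg_id.
exact.
Qed.

Lemma derive_local_max (R : realType) (V : normedModType R) (F P : V -> R)
    (x u : V) :
  (\forall y \near x, is_derive y u F (P y)) ->
  (\forall y \near x, F y <= F x) -> P x = 0.
Proof.
move=> dF Fx; have dF' := near_line u dF; have Fx' := near_line u Fx.
have /nbhs_norm0P[d /= d0 Hd] : \forall s \near (0 : R),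
    is_derive (x + s *: u) u F (P (x + s *: u)) /\ F (x + s *: u) <= F x.
  exact: filterI.
have inI t : t \in `]-d, d[ ->
    is_derive t 1 (fun r => F (x + r *: u)) (P (x + t *: u)) /\
    F (x + t *: u) <= F x.
  rewrite in_itv/= -ltr_norml => /Hd[H1 H2]; split => //.
  exact: is_derive_line.
have I0 : 0 \in `]-d, d[ by rewrite in_itv/= oppr_lt0 d0.
have [D0 _] := inI _ I0.
have D1 : is_derive (0 : R) (1 : R) (fun r : R => F (x + r *: u)) 0.
  apply: (@derive1_at_max _ _ (- d) d) => // [|t /inI[]//|t /inI[_]].
    by rewrite ge0_cp// ltW.
  by rewrite scale0r addr0.
have := @derive_val _ _ _ _ _ _ _ D0.
by rewrite (@derive_val _ _ _ _ _ _ _ D1) scale0r addr0 => ->.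
Qed.

(** For the directions [u] and [- u] the second difference at [x] is
[2 F x - F (x + s u) - F (x - s u)], which is nonnegative at a maximum. *)
Lemma second_derivative_local_max (R : realType) (V : normedModType R)
    (F P : V -> R) (x u : V) :
  (\forall y \near x, is_derive y u F (P y)) -> differentiable P x ->
  (\forall y \near x, F y <= F x) -> 'd P x u <= 0.
Proof.
move=> dF dP Fx.
have := second_difference_cvg dF dP (v := - u).
set f := (X in X @ _ --> _ -> _) => fl.
rewrite -oppr_ge0 -linearN.
rewrite -(cvg_lim _ fl)//; apply: limr_ge; first by apply/cvg_ex; eexists; exact: fl.
have Fu := near_line u Fx; have FNu := near_line (- u) Fx.
near=> s.
have s0 : 0 < s by near: s; exact: nbhs_right_gt.
rewrite /f divr_ge0 ?sqr_ge0// scalerN subrK.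
have H1 : F (x + s *: u) <= F x by near: s; apply: cvg_within; exact: Fu.
have H2 : F (x + s *: - u) <= F x by near: s; apply: cvg_within; exact: FNu.
by move: H1 H2; rewrite scalerN; lra.
Unshelve. all: end_near.
Qed.

(** * Euclidean Hessians *)

Definition hess (R : realType) (n : nat) (F : 'rV[R]_n -> R) (x : 'rV[R]_n) :
  'M[R]_n := \matrix_(i, j) partial i (partial j F) x.

(** A sum of partial derivatives rather than ['D_u F], so that it is differentiable
wherever the partial derivatives are. *)
Definition dir_derive (R : realType) (n : nat) (u : 'rV[R]_n) (F : 'rV[R]_n -> R)
   (x : 'rV[R]_n) : R := \sum_i u 0 i * partial i F x.

Lemma diff_partial (R : realType) (n : nat) (F : 'rV[R]_n -> R) (x u : 'rV[R]_n) :
  differentiable F x -> 'd F x u = dir_derive u F x.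
Proof.
move=> dF; rewrite {1}(row_sum_delta u) linear_sum; apply: eq_bigr => i _.
by rewrite linearZ /partial deriveE.
Qed.

Lemma is_derive_dir (R : realType) (n : nat) (F : 'rV[R]_n -> R) (x u : 'rV[R]_n) :
  differentiable F x -> is_derive x u F (dir_derive u F x).
Proof.
by move=> dF; split; [exact: diff_derivable|rewrite deriveE// diff_partial].
Qed.

Lemma is_diff_dir_derive (R : realType) (n : nat) (F : 'rV[R]_n -> R) (x u : 'rV[R]_n) :
  (forall i, differentiable (partial i F) x) ->
  differentiable (dir_derive u F) x /\
  forall v, 'd (dir_derive u F) x v = (v *m hess F x *m u^T) 0 0.
Proof.
move=> dF.
have E : dir_derive u F = \sum_i (u 0 i *: partial i F).
  by apply/funext => y; rewrite fct_sumE.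
have dd : differentiable (dir_derive u F) x.
  by rewrite E; apply: differentiable_sum => i; exact: differentiableZ.
split=> // v; rewrite -deriveE// E derive_sum; last first.
  by move=> i; apply: derivableZ; exact: diff_derivable.
rewrite mxE; apply: eq_bigr => i _.
rewrite deriveZ; last exact: diff_derivable.
rewrite deriveE// diff_partial// /dir_derive !mxE mulrC; congr (_ * _).
by apply: eq_bigr => j _; rewrite !mxE.
Qed.

Lemma hess_sym (R : realType) (n : nat) (F : 'rV[R]_n -> R) (x : 'rV[R]_n) :
  (\forall y \near x, differentiable F y) ->
  (forall i, differentiable (partial i F) x) -> (hess F x)^T = hess F x.
Proof.
move=> dF ddF; apply/matrixP => i j; rewrite !mxE /partial !deriveE; last 2 first.
  exact: ddF.
  exact: ddF.
apply: (@mixed_derivativesC _ _ F _ _ x _ _ _ _ (ddF i) (ddF j));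
  by apply: filterS dF => y dFy; split=> //; exact: diff_derivable.
Qed.

(** First and second order conditions for [H1 - t H2] to have a local maximum,
equal to 0, at [x]. *)
Lemma touching_jets (R : realType) (n : nat) (H1 H2 : 'rV[R]_n -> R) (x : 'rV[R]_n)
    (t : R) :
  (\forall y \near x, differentiable H1 y) ->
  (forall i, differentiable (partial i H1) x) ->
  (\forall y \near x, differentiable H2 y) ->
  (forall i, differentiable (partial i H2) x) ->
  (\forall y \near x, H1 y <= t * H2 y) -> H1 x = t * H2 x ->
  forall u, dir_derive u H1 x = t * dir_derive u H2 x /\
            quad (hess H1 x) u <= t * quad (hess H2 x) u.
Proof.
move=> d1 dd1 d2 dd2 le12 eq12 u.
pose F := H1 - t *: H2; pose P := dir_derive u H1 - t *: dir_derive u H2.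
have [dP1 E1] := is_diff_dir_derive u dd1.
have [dP2 E2] := is_diff_dir_derive u dd2.
have dF : \forall y \near x, is_derive y u F (P y).
  near=> y; apply: is_deriveB; first by apply: is_derive_dir; near: y.
  by apply: is_deriveZ; apply: is_derive_dir; near: y.
have dP : differentiable P x by apply: differentiableB => //; exact: differentiableZ.
have Fx : \forall y \near x, F y <= F x.
  apply: filterS le12 => y le_y.
  by rewrite /F !fctE /= -[_ *: H2 y]/(_ * _) -[_ *: H2 x]/(_ * _) eq12 subrr subr_le0.
split.
  by apply/eqP; rewrite -subr_eq0; apply/eqP; exact: derive_local_max dF Fx.
have quadE H : (forall v, 'd (dir_derive u H) x v = (v *m hess H x *m u^T) 0 0) ->
    quad (hess H x) u = 'd (dir_derive u H) x u by move=> ->.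
rewrite -subr_le0 (quadE _ E1) (quadE _ E2).
have -> : 'd (dir_derive u H1) x u - t * 'd (dir_derive u H2) x u = 'd P x u.
  by rewrite /P diffB ?diffZ//; exact: differentiableZ.
exact: second_derivative_local_max dF dP Fx.
Unshelve. all: end_near.
Qed.

(** * Spherical derivatives through the radial extension *)

Lemma radial_ext_sphere (R : realType) (n : nat) (h : 'rV[R]_n -> R) x :
  sphere R n x -> radial_ext h x = h x.
Proof. by move=> x1; rewrite /radial_ext /normalize x1 invr1 scale1r. Qed.

Lemma radial_ext_near (R : realType) (n : nat) (h : 'rV[R]_n -> R) (x : 'rV[R]_n) :
  smooth_on_sphere h -> x != 0 ->
  (\forall y \near x, differentiable (radial_ext h) y) /\
  (forall i, differentiable (partial i (radial_ext h)) x).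
Proof.
move=> sh x0; split=> [|i]; last exact: (sh [:: i]).
by apply: filterS (near_neq0 x0) => y y0; exact: (sh [::]).
Qed.

(** The extension is homogeneous of degree 0, so its partial derivatives are
homogeneous of degree -1. *)
Lemma partial_radial_ext (R : realType) (n : nat) (h : 'rV[R]_n -> R) i c y :
  0 < c -> differentiable (radial_ext h) (c *: y) ->
  partial i (radial_ext h) y = c * partial i (radial_ext h) (c *: y).
Proof.
move=> c0 dh; set H := radial_ext h in dh *.
have HE : H = H \o ( *:%R c) by apply/funext => z; rewrite /H /radial_ext /= normalizeZ.
rewrite /partial {1}HE deriveE; last exact: differentiable_comp.
rewrite diff_comp//= diff_val linearZ/= deriveE//.
Qed.

Lemma sgrad_normalize (R : realType) (n : nat) (h : 'rV[R]_n -> R) i y :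
  smooth_on_sphere h -> y != 0 ->
  sgrad h (normalize y) 0 i = enorm y * partial i (radial_ext h) y.
Proof.
move=> sh y0; have e0 : 0 < enorm y by rewrite enorm_gt0.
rewrite mxE (@partial_radial_ext _ _ _ _ (enorm y)^-1 y) ?invr_gt0//.
  by rewrite mulrA mulfV ?mul1r ?gt_eqF.
exact: (sh [::]) (sphere_neq0 (normalize_sphere y0)).
Qed.

(** By [sgrad_normalize] the field differentiated in [shess] is [|y| grad H y], and
the factor [|y|] has derivative 0 in the tangent directions. *)
Lemma shessE (R : realType) (n : nat) (h : 'rV[R]_n -> R) (x v w : 'rV[R]_n) :
  smooth_on_sphere h -> sphere R n x -> dot v x = 0 ->
  shess h x v w = (v *m hess (radial_ext h) x *m w^T) 0 0.
Proof.
move=> sh x1 vx; set H := radial_ext h; have x0 := sphere_neq0 x1.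
have dH i : differentiable (partial i H) x by exact: (sh [:: i]).
have near_sg i : \forall y \near x,
    enorm y * partial i H y = sgrad h (normalize y) 0 i.
  by apply: filterS (near_neq0 x0) => y y0; rewrite sgrad_normalize.
have isd i :
    is_derive x v (fun y => sgrad h (normalize y) 0 i) ('D_v (partial i H) x).
  apply: (near_eq_is_derive (near_sg i)).
  have := is_deriveM (is_derive_enorm x1 vx)
    (derivableP (@diff_derivable _ _ _ _ _ v (dH i))).
  by rewrite x1 scale1r scaler0 addr0.
rewrite /shess /dot mxE; apply: eq_bigr => i _; rewrite [w^T _ _]mxE; congr (_ * _).
rewrite derive_mx; last first.
  by apply/derivable_mxP => k j; rewrite ord1; have [] := isd j.
rewrite mxE; have [_ ->] := isd i.
rewrite mxE deriveE// diff_partial//.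
by apply: eq_bigr => j _; rewrite !mxE.
Qed.

Lemma shess_plus_mxE (R : realType) (n : nat) (h : 'rV[R]_n -> R) (x : 'rV[R]_n)
    (E : 'M[R]_(n.-1, n)) :
  smooth_on_sphere h -> sphere R n x -> orthonormal_frame x E ->
  shess_plus_mx h x E = E *m (hess (radial_ext h) x + (h x)%:M) *m E^T.
Proof.
move=> sh x1 oE.
rewrite mulmxDr mulmxDl mul_mx_scalar -scalemxAl (orthonormal_frame_mul oE).
rewrite scale_scalar_mx mulr1 /shess_plus_mx; congr (_ + _).
apply/matrixP => i j; rewrite mxE shessE//; last by have [_ ->] := oE.
by rewrite -row_mul tr_row !mxE; apply: eq_bigr => k _; rewrite !mxE.
Qed.

(** * Comparison of solutions *)

Lemma powR_sq_scale (R : realType) (n : nat) (t a : R) : 0 < t -> 0 <= a ->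
  (t ^+ 2 * a) `^ (- (n%:R / 2)) = t ^- n * a `^ (- (n%:R / 2)).
Proof.
move=> t0 a0; rewrite powRM ?sqr_ge0//; congr (_ * _).
rewrite -powR_mulrn ?ltW// -powRrM mulrN powRN mulrC divfK// powR_mulrn// ltW//.
Qed.

Lemma solution_le (R : realType) (n : nat) (f : 'rV[R]_n -> R) (phi : R -> R)
    (h1 h2 : 'rV[R]_n -> R) :
  (0 < n)%N ->
  (forall t, 0 < t -> 0 < phi t) ->
  (forall s t, 0 < s -> s < t -> phi s < phi t) ->
  is_solution phi f h1 -> is_solution phi f h2 ->
  forall x, sphere R n x -> h1 x <= h2 x.
Proof.
move=> n0 phi_pos phi_incr [s1 p1 c1 e1] [s2 p2 c2 e2] x0 x0S.
rewrite leNgt; apply/negP => lt12.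
pose H1 := radial_ext h1; pose H2 := radial_ext h2.
have H1E y : sphere R n y -> H1 y = h1 y by exact: radial_ext_sphere.
have H2E y : sphere R n y -> H2 y = h2 y by exact: radial_ext_sphere.
have [c /[!inE] cS cmax] : exists2 c, c \in sphere R n &
    forall y, y \in sphere R n -> H1 y / H2 y <= H1 c / H2 c.
  apply: EVT_max_rV; [by exists x0|exact: compact_sphere|].
  apply: continuous_in_subspaceT => y /[!inE] yS.
  have y0 := sphere_neq0 yS.
  apply: differentiable_continuous; apply: differentiableM; first exact: (s1 [::]).
  by apply: differentiableV; [exact: (s2 [::])|rewrite H2E// gt_eqF// p2].
pose t := H1 c / H2 c.
have h2c := p2 _ cS.
have t1 : 1 < t.
  apply: lt_le_trans (cmax x0 _); last by rewrite inE.
  by rewrite H1E// H2E// ltr_pdivlMr ?mul1r// p2.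
have t0 : 0 < t by rewrite (lt_trans ltr01).
have eqc : h1 c = t * h2 c by rewrite /t H1E// H2E// divfK// gt_eqF.
have le12 y : y != 0 -> H1 y <= t * H2 y.
  move=> y0; have yS := normalize_sphere y0.
  have := cmax (normalize y); rewrite inE => /(_ yS).
  by rewrite H1E// H2E// -/t ler_pdivrMr// p2.
have c0 := sphere_neq0 cS.
have [d1 dd1] := radial_ext_near s1 c0; have [d2 dd2] := radial_ext_near s2 c0.
have near_le : \forall y \near c, H1 y <= t * H2 y.
  by apply: filterS (near_neq0 c0) => y /le12.
have eqH : H1 c = t * H2 c by rewrite H1E// H2E.
have touch := touching_jets d1 dd1 d2 dd2 near_le eqH.
have gradE : sgrad h1 c = t *: sgrad h2 c.
  apply/rowP => i; rewrite !mxE; have [+ _] := touch (delta_mx 0 i).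
  have dE (F : 'rV[R]_n -> R) : dir_derive (delta_mx 0 i) F c = partial i F c.
    rewrite /dir_derive (bigD1 i)//= big1 => [|j /negPf ji].
      by rewrite mxE !eqxx mul1r addr0.
    by rewrite mxE ji andbF mul0r.
  by rewrite !dE.
have [E oE] := orthonormal_frame_exists n0 ((sphereP c).1 cS).
set A1 := shess_plus_mx h1 c E; set A2 := shess_plus_mx h2 c E.
have A1E := shess_plus_mxE s1 cS oE; have A2E := shess_plus_mxE s2 cS oE.
have /andP[D1 D12] : 0 < \det A1 <= \det (t *: A2).
  apply: ler_det_posdef => [|u u0|u].
  - rewrite /A1 A1E !trmx_mul trmxK linearD/= tr_scalar_mx hess_sym//.
    by rewrite mulmxA.
  - rewrite /A1 A1E quad_congruence quad_add_scalar.
    have uE := orthonormal_frame_tangent u oE.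
    rewrite /quad -shessE// c1//; apply: contra_neq u0 => uE0.
    by rewrite -[u]mulmx1 -(orthonormal_frame_mul oE) mulmxA uE0 mul0mx.
  - have -> : quad (t *: A2) u = t * quad A2 u.
      by rewrite /quad -scalemxAr -scalemxAl mxE.
    rewrite /A1 /A2 A1E A2E !quad_congruence !quad_add_scalar mulrDr mulrA eqc.
    by rewrite lerD2r; have [] := touch (u *m E).
move: D12; rewrite detZ => D12.
have f1 := e1 c cS E oE; have f2 := e2 c cS E oE.
rewrite -/A1 -/A2 in f1 f2.
set Q2 := enorm (sgrad h2 c) ^+ 2 + h2 c ^+ 2 in f2.
have Q2_gt0 : 0 < Q2 by rewrite ltr_wpDl ?sqr_ge0// exprn_gt0.
have Q1E : enorm (sgrad h1 c) ^+ 2 + h1 c ^+ 2 = t ^+ 2 * Q2.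
  by rewrite gradE enormZ gtr0_norm// eqc /Q2; ring.
rewrite Q1E powR_sq_scale ?(ltW Q2_gt0)// in f1.
set q := Q2 `^ _ in f1 f2; have q0 : 0 < q by exact: powR_gt0.
have D2 : 0 < \det A2 by have := lt_le_trans D1 D12; rewrite pmulr_rgt0// exprn_gt0.
(* The powers of [t] from the gradient factor and from the determinant cancel. *)
have K : t * t ^- n * \det A1 <= \det A2.
  have -> : t * t ^- n = t ^- n.-1.
    by rewrite -[in LHS](prednK n0) exprS invfM mulrA mulfV ?mul1r// gt_eqF.
  by rewrite ler_pdivrMl// exprn_gt0.
have ph : phi (1 / h1 c) < phi (1 / h2 c).
  apply: phi_incr; first by rewrite divr_gt0// p1.
  by rewrite !div1r eqc ltf_pV2 ?ltr_pMl// posrE mulr_gt0.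
have pp : 0 < phi (1 / h1 c) by apply: phi_pos; rewrite divr_gt0// p1.
suff : f c < f c by rewrite ltxx.
rewrite -{1}f1 -f2.
have -> : phi (1 / h1 c) * h1 c * (t ^- n * q) * \det A1 =
  (h2 c * q) * (phi (1 / h1 c) * (t * t ^- n * \det A1)) by rewrite {2}eqc; ring.
have -> : phi (1 / h2 c) * h2 c * q * \det A2 =
  (h2 c * q) * (phi (1 / h2 c) * \det A2) by ring.
rewrite ltr_pM2l ?mulr_gt0//.
apply: le_lt_trans (_ : phi (1 / h1 c) * \det A2 < _); first by rewrite ler_pM2l.
by rewrite ltr_pM2r.
Qed.

Unset Implicit Arguments.

Theorem theorem6p1 (R : realType) (n : nat) (hn : (0 < n)%N)
    (f : 'rV[R]_n -> R) (phi : R -> R) (Omega0 : set 'rV[R]_n)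
    (f_pos : forall x, sphere R n x -> 0 < f x)
    (f_smooth : smooth_on_sphere f)
    (f_even : forall x, sphere R n x -> f (- x) = f x)
    (phi_pos : forall t, 0 < t -> 0 < phi t)
    (phi_smooth : smooth_pos phi)
    (Omega0_body : smooth_strictly_convex_body Omega0)
    (Omega0_sym : forall y, Omega0 y -> Omega0 (- y))
    (cond :
      (exists r : R -> R,
        [/\ Phi0 r,
            forall s, 0 < s ->
              (r s)%:E =
              (\int[@lebesgue_measure R]_(t in `]0%R, s[) ((t * phi t)^-1)%:E)%E,
            forall s, 0 < s -> derive1 r s != 0
          & exists C : R,
              [/\ 0 < C,
                  forall theta, sphere R n theta ->
                    (sphere_integral
                       (fun x => (f x * r (1 / `|dot x theta|))%:E) <= C%:E)%E
                & (C%:E < sphere_integral (fun x =>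
                     (f x * r (1 / support_function Omega0 x))%:E))%E]])
      \/
      (exists r : R -> R,
        [/\ Psi0 r,
            forall s, 0 < s ->
              (r s)%:E =
              (\int[@lebesgue_measure R]_(t in `]s, +oo[) ((t * phi t)^-1)%:E)%E
          & forall s, 0 < s -> derive1 r s != 0]))
    (phi_incr : forall s t, 0 < s -> s < t -> phi s < phi t)
    (h1 h2 : 'rV[R]_n -> R)
    (sol1 : is_solution phi f h1) (sol2 : is_solution phi f h2) :
  forall x, sphere R n x -> h1 x = h2 x.
Proof.
move=> x xS; apply/eqP; rewrite eq_le.
by rewrite (solution_le hn phi_pos phi_incr sol1 sol2 xS)
  (solution_le hn phi_pos phi_incr sol2 sol1 xS).
Qed.
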